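(* For each $\tau\in\Sigma({}_M\mathcal X_M^0)$, the family $\{\mathcal E^\mp_\tau(\beta)\}_{\beta\in\Phi}$ is a half-braiding for $\tau$ with respect to the system $\Phi={}_M\mathcal X_M^\pm$ (i.e. $\{\mathcal E^-_\tau(\beta)\}$ with respect to ${}_M\mathcal X_M^+$ and $\{\mathcal E^+_\tau(\beta)\}$ with respect to ${}_M\mathcal X_M^-$).
   Context: Conventions. All factors are type III von Neumann factors and all morphisms have finite statistical dimension. A $B$-$A$ morphism is a unital $*$-homomorphism $\rho:A\to B$; $d_\rho=[B:\rho(A)]^{1/2}$ (minimal index). $\mathrm{Hom}(\rho,\sigma)=\{t\in B:\ t\rho(a)=\sigma(a)t\ \forall a\in A\}$. A conjugate of $\rho$ is $\bar\rho:B\to A$ admitting isometries $r_\rho\in\mathrm{Hom}(\mathrm{id}_A,\bar\rho\rho)$, $\bar r_\rho\in\mathrm{Hom}(\mathrm{id}_B,\rho\bar\rho)$ with $\rho(r_\rho)^*\bar r_\rho=d_\rho^{-1}\mathbf 1$, $\bar\rho(\bar r_\rho)^*r_\rho=d_\rho^{-1}\mathbf 1$. The sector $[\rho]$ is the unitary equivalence class; $[\sigma]$ is a subsector of $[\rho]$ if $\mathrm{Hom}(\sigma,\rho)$ contains an isometry; sums of morphisms are $\sum_i t_i\rho_i(\cdot)t_i^*$ with isometries $t_i$ satisfying the Cuntz relations. A finite system $\Delta\subset\mathrm{End}(A)$ is a finite set of irreducible, pairwise inequivalent endomorphisms containing $\mathrm{id}$ and closed, up to unitary equivalence, under conjugates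 and under decomposition of products into irreducibles. $\Sigma(\Delta)$ is the set of finite sums of morphisms in $\Delta$. Braiding. $\Delta$ is braided if there are unitaries $\varepsilon(\lambda,\mu)\in\mathrm{Hom}(\lambda\mu,\mu\lambda)$, $\lambda,\mu\in\Delta$, with $\varepsilon(\mathrm{id},\mu)=\varepsilon(\lambda,\mathrm{id})=\mathbf 1$ and, for all $t\in\mathrm{Hom}(\lambda,\mu\nu)$ and $\rho\in\Delta$, $\rho(t)\varepsilon(\lambda,\rho)=\varepsilon(\mu,\rho)\mu(\varepsilon(\nu,\rho))t$ and $t\varepsilon(\rho,\lambda)=\mu(\varepsilon(\rho,\nu))\varepsilon(\rho,\mu)\rho(t)$, together with $\rho(t)^*\varepsilon(\mu,\rho)\mu(\varepsilon(\nu,\rho))=\varepsilon(\lambda,\rho)t^*$ and $t^*\mu(\varepsilon(\rho,\nu))\varepsilon(\rho,\mu)=\varepsilon(\rho,\lambda)\rho(t)^*$. It extends to $\Sigma(\Delta)$ by $\varepsilon(\lambda,\mu)=\sum_{i,j}s_j\mu_j(t_i)\varepsilon(\lambda_i,\mu_j)\lambda_i(s_j)^*t_i^*$ for $\lambda=\sum_i t_i\lambda_i(\cdot)t_i^*$, $\mu=\sum_j s_j\mu_j(\cdot)s_j^*$. $\varepsilon^+=\varepsilon$, $\varepsilon^-(\lambda,\mu)=\varepsilon(\mu,\lambda)^*$. Standing assumption. $N\subset M$ is a type III subfactor, $\iota:N\hookrightarrow M$ the inclusion, $\bar\iota:M\to N$ a conjugate, $\theta=\bar\iota\iota$. ${}_N\mathcal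 X_N\subset\mathrm{End}(N)$ is a finite braided system, ${}_N\mathcal Y_N\subset{}_N\mathcal X_N$ a subsystem, and $\theta\in\Sigma({}_N\mathcal Y_N)$. For $\lambda\in\Sigma({}_N\mathcal X_N)$, $\alpha^\pm_\lambda=\bar\iota^{\,-1}\circ\mathrm{Ad}(\varepsilon^\pm(\lambda,\theta))\circ\lambda\circ\bar\iota\in\mathrm{End}(M)$ (well defined; extends $\lambda$). ${}_M\mathcal X_M\subset\mathrm{End}(M)$ is a choice of representatives (with $\mathrm{id}$ for the trivial sector) of all irreducible subsectors of $[\iota\lambda\bar\iota]$, $\lambda\in{}_N\mathcal X_N$. ${}_M\mathcal X_M^\pm$ is the subsystem of $\beta\in{}_M\mathcal X_M$ with $[\beta]$ a subsector of $[\alpha^\pm_\lambda]$ for some $\lambda\in{}_N\mathcal X_N$; ${}_M\mathcal X_M^0={}_M\mathcal X_M^+\cap{}_M\mathcal X_M^-$. Relative braiding. For $\beta_\pm\in\Sigma({}_M\mathcal X_M^\pm)$, $\mathcal E_{\mathrm r}(\beta_+,\beta_-)=S^*\alpha^-_\mu(T)^*\varepsilon^+(\lambda,\mu)\alpha^+_\lambda(S)T$ for any isometries $T\in\mathrm{Hom}(\beta_+,\alpha^+_\lambda)$, $S\in\mathrm{Hom}(\beta_-,\alpha^-_\mu)$ with $\lambda,\mu\in\Sigma({}_N\mathcal X_N)$; this is a unitary in $\mathrm{Hom}(\beta_+\beta_-,\beta_-\beta_+)$, independent of the choices. For $\tau\in\Sigma({}_M\mathcal X_M^0)$ put $\mathcal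 E^-_\tau(\beta)=\mathcal E_{\mathrm r}(\beta,\tau)^*$ for $\beta\in{}_M\mathcal X_M^+$ and $\mathcal E^+_\tau(\beta)=\mathcal E_{\mathrm r}(\tau,\beta)$ for $\beta\in{}_M\mathcal X_M^-$. Half-braiding. For a system $\Phi\subset\mathrm{End}(M)$, a half-braiding of $\sigma\in\Sigma(\Phi)$ with respect to $\Phi$ is a family of unitaries $\{\mathcal E_\sigma(\beta)\}_{\beta\in\Phi}$ with (1) $\mathcal E_\sigma(\beta)\in\mathrm{Hom}(\sigma\beta,\beta\sigma)$ for all $\beta\in\Phi$, and (2) $X\mathcal E_\sigma(\beta_3)=\beta_1(\mathcal E_\sigma(\beta_2))\mathcal E_\sigma(\beta_1)\sigma(X)$ for all $\beta_1,\beta_2,\beta_3\in\Phi$ and $X\in\mathrm{Hom}(\beta_3,\beta_1\beta_2)$. *)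

(* Defs.v *)
From HB Require Import structures.
From mathcomp Require Import all_boot all_order all_algebra.
From mathcomp Require Import sesquilinear complex.
From mathcomp Require Import all_classical all_reals all_analysis.

Set Implicit Arguments.
Unset Strict Implicit.
Unset Printing Implicit Defensive.

Import Order.TTheory GRing.Theory Num.Theory.
Import numFieldNormedType.Exports.

Local Open Scope classical_set_scope.
Local Open Scope ring_scope.
Local Open Scope complex_scope.

(** * Bounded operators on a Hilbert space *)

(* The inner product is linear in its first argument. Hilbert spaces are taken
   to be nonzero, so that operator algebras satisfy 1 <> 0. *)
Record hilbert (R : realType) := Hilbert {
  hsort :> completeNormedModType R[i];
  hdot : {dot hsort for @Num.conj R[i]};
  hdot_norm : forall u : hsort, hdot u u = `|u| ^+ 2;
  hilbert_neq0 : exists u : hsort, u != 0 }.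

(* An operator is stored with its adjoint. Every bounded operator on a Hilbert
   space has exactly one adjoint, so this is the algebra B(H). *)
Record bop (R : realType) (H : hilbert R) := Bop {
  bop_fun :> H -> H;
  bop_adj : H -> H;
  bop_lin : linear bop_fun;
  bop_cont : continuous bop_fun;
  bop_adj_lin : linear bop_adj;
  bop_adj_cont : continuous bop_adj;
  bop_adjP : forall u v, hdot H (bop_fun u) v = hdot H u (bop_adj v) }.

Section BopAlgebra.
Variables (R : realType) (H : hilbert R).
Implicit Types x y z : bop H.

Lemma hdot_inj (u v : H) : (forall w, hdot H w u = hdot H w v) -> u = v.
Proof.
move=> e; apply/eqP; rewrite -subr_eq0; apply/negP => /negP /(@neq0_dnorm_gt0 _ _ _ (hdot H)).
by rewrite raddfB /= e subrr ltxx.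
Qed.

Lemma hdotC (u v : H) : hdot H u v = (hdot H v u)^*%R.
Proof. by rewrite (hermitian_subproof (s := hdot H) u v) expr0 mul1r. Qed.

Lemma bop_adjP' x u v : hdot H (bop_adj x u) v = hdot H u (x v).
Proof. by rewrite hdotC -bop_adjP -hdotC. Qed.

Lemma bopP x y : (forall u, x u = y u) -> x = y.
Proof.
move=> e.
have e1 : bop_fun x = bop_fun y by apply/funext.
have e2 : bop_adj x = bop_adj y.
  by apply/funext => v; apply: hdot_inj => w; rewrite -!bop_adjP e.
case: x y e1 e2 {e} => f g p1 p2 p3 p4 p5 [f' g' q1 q2 q3 q4 q5] /= e1 e2.
by subst f' g'; congr Bop; apply: Prop_irrelevance.
Qed.

HB.instance Definition _ := gen_eqMixin (bop H).
HB.instance Definition _ := gen_choiceMixin (bop H).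

Lemma linear0_fun (f : H -> H) : linear f -> f 0 = 0.
Proof. by move=> lf; move: (lf (-1) 0 0); rewrite scaler0 addr0 scaleN1r addNr. Qed.

Lemma linearD_fun (f : H -> H) : linear f -> forall u v, f (u + v) = f u + f v.
Proof. by move=> lf u v; move: (lf 1 u v); rewrite !scale1r. Qed.

Lemma linearZ_fun (f : H -> H) : linear f -> forall a u, f (a *: u) = a *: f u.
Proof. by move=> lf a u; move: (lf a u 0); rewrite !addr0 linear0_fun// addr0. Qed.

Lemma hdotDl (u v w : H) : hdot H (u + v) w = hdot H u w + hdot H v w.
Proof. exact: linearDl. Qed.

Lemma hdotDr (u v w : H) : hdot H w (u + v) = hdot H w u + hdot H w v.
Proof. exact: linearDr. Qed.

Lemma hdotZl a (u w : H) : hdot H (a *: u) w = a * hdot H u w.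
Proof. exact: linearZl_LR. Qed.

Lemma hdotZr a (u w : H) : hdot H w (a *: u) = (a^*)%R * hdot H w u.
Proof. exact: linearZr_LR. Qed.

Lemma lin_lin2 (f g : H -> H) (a b : R[i]) : linear f -> linear g ->
  linear (fun u => a *: f u + b *: g u).
Proof.
move=> lf lg c u v; rewrite lf lg !scalerDr !scalerA (mulrC c a) (mulrC c b).
by rewrite addrACA.
Qed.

Lemma cont_lin2 (f g : H -> H) (a b : R[i]) : continuous f -> continuous g ->
  continuous (fun u => a *: f u + b *: g u).
Proof. by move=> cf cg u; apply: cvgD; apply: cvgZl_tmp; [exact: cf|exact: cg]. Qed.

Program Definition bop_lin2 (a b : R[i]) x y : bop H :=
  @Bop R H (fun u => a *: x u + b *: y u)
    (fun u => a^*%R *: bop_adj x u + b^*%R *: bop_adj y u) _ _ _ _ _.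
Next Obligation. by move=> a b x y; apply: lin_lin2; apply: bop_lin. Qed.
Next Obligation. by move=> a b x y; apply: cont_lin2; apply: bop_cont. Qed.
Next Obligation. by move=> a b x y; apply: lin_lin2; apply: bop_adj_lin. Qed.
Next Obligation. by move=> a b x y; apply: cont_lin2; apply: bop_adj_cont. Qed.
Next Obligation.
by move=> a b x y u v; rewrite hdotDl hdotDr !hdotZl !hdotZr !bop_adjP !conjCK.
Qed.

Program Definition bop_one : bop H := @Bop R H id id _ _ _ _ _.
Next Obligation. by move=> a u v. Qed.
Next Obligation. by move=> u; apply: cvg_id. Qed.
Next Obligation. by move=> a u v. Qed.
Next Obligation. by move=> u; apply: cvg_id. Qed.
Next Obligation. by []. Qed.

Program Definition bop_mul x y : bop H :=
  @Bop R H (x \o y) (bop_adj y \o bop_adj x) _ _ _ _ _.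
Next Obligation. by move=> x y a u v /=; rewrite !bop_lin. Qed.
Next Obligation. by move=> x y u; apply: continuous_comp; apply: bop_cont. Qed.
Next Obligation. by move=> x y a u v /=; rewrite !bop_adj_lin. Qed.
Next Obligation. by move=> x y u; apply: continuous_comp; apply: bop_adj_cont. Qed.
Next Obligation. by move=> x y u v /=; rewrite !bop_adjP. Qed.

Program Definition bop_star x : bop H := @Bop R H (bop_adj x) x _ _ _ _ _.
Next Obligation. by move=> x; apply: bop_adj_lin. Qed.
Next Obligation. by move=> x; apply: bop_adj_cont. Qed.
Next Obligation. by move=> x; apply: bop_lin. Qed.
Next Obligation. by move=> x; apply: bop_cont. Qed.
Next Obligation. by move=> x u v; apply: bop_adjP'. Qed.

Definition bop_zero : bop H := bop_lin2 0 0 bop_one bop_one.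
Definition bop_add x y : bop H := bop_lin2 1 1 x y.
Definition bop_opp x : bop H := bop_lin2 (-1) 0 x x.
Definition bop_scale (a : R[i]) x : bop H := bop_lin2 a 0 x x.

Lemma bop_addE x y u : bop_add x y u = x u + y u.
Proof. by rewrite /= !scale1r. Qed.
Lemma bop_zeroE u : bop_zero u = 0.
Proof. by rewrite /= !scale0r addr0. Qed.
Lemma bop_oppE x u : bop_opp x u = - x u.
Proof. by rewrite /= scaleN1r scale0r addr0. Qed.
Lemma bop_scaleE a x u : bop_scale a x u = a *: x u.
Proof. by rewrite /= scale0r addr0. Qed.

Lemma bop_addA : associative bop_add.
Proof. by move=> x y z; apply: bopP => u; rewrite !bop_addE addrA. Qed.
Lemma bop_addC : commutative bop_add.
Proof. by move=> x y; apply: bopP => u; rewrite !bop_addE addrC. Qed.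
Lemma bop_add0 : left_id bop_zero bop_add.
Proof. by move=> x; apply: bopP => u; rewrite bop_addE bop_zeroE add0r. Qed.
Lemma bop_addN : left_inverse bop_zero bop_opp bop_add.
Proof. by move=> x; apply: bopP => u; rewrite bop_addE bop_zeroE bop_oppE addNr. Qed.

HB.instance Definition _ :=
  GRing.isZmodule.Build (bop H) bop_addA bop_addC bop_add0 bop_addN.

Lemma bop_mulA : associative bop_mul.
Proof. by move=> x y z; apply: bopP. Qed.
Lemma bop_mul1 : left_id bop_one bop_mul.
Proof. by move=> x; apply: bopP. Qed.
Lemma bop_1mul : right_id bop_one bop_mul.
Proof. by move=> x; apply: bopP. Qed.
Lemma bop_mulDl : left_distributive bop_mul +%R.
Proof.
move=> x y z; apply: bopP => u.
exact: etrans (bop_addE x y (z u)) (esym (bop_addE (bop_mul x z) (bop_mul y z) u)).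
Qed.
Lemma bop_mulDr : right_distributive bop_mul +%R.
Proof.
move=> x y z; apply: bopP => u.
apply: etrans (esym (bop_addE (bop_mul x y) (bop_mul x z) u)).
by rewrite [LHS]/= !scale1r (linearD_fun (@bop_lin _ _ x)).
Qed.
Lemma bop_one_neq0 : bop_one != 0.
Proof.
apply/eqP => e; have [u /eqP] := hilbert_neq0 H; apply.
by have := congr1 (fun x : bop H => x u) e; rewrite [RHS]bop_zeroE.
Qed.

HB.instance Definition _ := GRing.Zmodule_isNzRing.Build (bop H)
  bop_mulA bop_mul1 bop_1mul bop_mulDl bop_mulDr bop_one_neq0.

Lemma bop_scaleA a b x : bop_scale a (bop_scale b x) = bop_scale (a * b) x.
Proof. by apply: bopP => u; rewrite !bop_scaleE scalerA. Qed.
Lemma bop_scale1 : left_id 1 bop_scale.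
Proof. by move=> x; apply: bopP => u; rewrite bop_scaleE scale1r. Qed.
Lemma bop_scaleDr : right_distributive bop_scale +%R.
Proof.
by move=> a x y; apply: bopP => u; rewrite bop_scaleE !bop_addE !bop_scaleE scalerDr.
Qed.
Lemma bop_scaleDl x : {morph bop_scale^~ x : a b / a + b}.
Proof. by move=> a b; apply: bopP => u; rewrite bop_addE !bop_scaleE scalerDl. Qed.

HB.instance Definition _ := GRing.Zmodule_isLmodule.Build R[i] (bop H)
  bop_scaleA bop_scale1 bop_scaleDr bop_scaleDl.

Lemma bop_scaleAl a x y : a *: (x * y) = (a *: x) * y.
Proof. by apply: bopP => u; rewrite [LHS]bop_scaleE /= scale0r addr0. Qed.
HB.instance Definition _ := GRing.Lmodule_isLalgebra.Build R[i] (bop H) bop_scaleAl.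
Lemma bop_scaleAr a x y : a *: (x * y) = x * (a *: y).
Proof.
apply: bopP => u; rewrite [LHS]bop_scaleE [RHS]/= scale0r addr0.
by rewrite (linearZ_fun (@bop_lin _ _ x)).
Qed.
HB.instance Definition _ := GRing.Lalgebra_isAlgebra.Build R[i] (bop H) bop_scaleAr.

Definition commutant (S : set (bop H)) : set (bop H) :=
  [set x | forall y, S y -> x * y = y * x].

End BopAlgebra.

(** * Von Neumann algebras *)

Record vnAlg (R : realType) (H : hilbert R) := VnAlg {
  vn_set : set (bop H);
  vn_star_closed : forall x, vn_set x -> vn_set (bop_star x);
  vn_bicommutant : commutant (commutant vn_set) = vn_set }.

Section VnAlgebra.
Variables (R : realType) (H : hilbert R).

Definition vn_mem (M : vnAlg H) : bop H -> bool := fun x => `[< vn_set M x >].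

Lemma vn_subalg_closed (M : vnAlg H) : GRing.subsemialg_closed (vn_mem M).
Proof.
have memE x : (x \in vn_mem M) = `[< commutant (commutant (vn_set M)) x >].
  by rewrite vn_bicommutant.
split.
- by rewrite memE; apply/asboolP => y _; rewrite mul1r mulr1.
- split; first by rewrite memE; apply/asboolP => y _; rewrite mul0r mulr0.
  move=> x y; rewrite !memE => /asboolP hx /asboolP hy; apply/asboolP => z hz.
  by rewrite mulrDl mulrDr hx// hy.
- move=> a x; rewrite !memE => /asboolP hx; apply/asboolP => z hz.
  by rewrite -scalerAl -scalerAr hx.
- move=> x y; rewrite !memE => /asboolP hx /asboolP hy; apply/asboolP => z hz.
  by rewrite -mulrA hy// mulrA hx// mulrA.
Qed.

HB.instance Definition _ (M : vnAlg H) :=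
  GRing.isSubalgClosed.Build R[i] (bop H) (vn_mem M) (vn_subalg_closed M).

Record vn_elt (M : vnAlg H) := VnElt { vn_val : bop H; vn_valP : vn_mem M vn_val }.

HB.instance Definition _ (M : vnAlg H) := [isSub for @vn_val M].
HB.instance Definition _ (M : vnAlg H) := [Choice of vn_elt M by <:].
HB.instance Definition _ (M : vnAlg H) := [SubChoice_isSubAlgebra of vn_elt M by <:].

Lemma vn_star_mem (M : vnAlg H) (x : vn_elt M) : vn_mem M (bop_star (vn_val x)).
Proof. by apply/asboolP/vn_star_closed/asboolP/vn_valP. Qed.

Definition vn_star (M : vnAlg H) (x : vn_elt M) : vn_elt M := VnElt (vn_star_mem x).

Lemma vn_incl_mem (N M : vnAlg H) (NM : vn_set N `<=` vn_set M) (x : vn_elt N) :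
  vn_mem M (vn_val x).
Proof. by apply/asboolP/NM/asboolP/vn_valP. Qed.

Definition vn_incl (N M : vnAlg H) (NM : vn_set N `<=` vn_set M) (x : vn_elt N) :
  vn_elt M := VnElt (vn_incl_mem NM x).

End VnAlgebra.

Coercion vn_elt : vnAlg >-> Sortclass.
Notation "x ^†" := (vn_star x) (at level 1, format "x ^†") : ring_scope.

Section Factors.
Variables (R : realType) (H : hilbert R) (M : vnAlg H).
Implicit Types x y p u : M.

Definition vn_pos x : Prop := forall v : H, 0 <= hdot H (vn_val x v) v.
Definition vn_le x y : Prop := vn_pos (y - x).

Definition is_isometry u : Prop := u^† * u = 1.
Definition is_unitary u : Prop := u^† * u = 1 /\ u * u^† = 1.
Definition is_projection p : Prop := p^† = p /\ p * p = p.

Definition finite_projection p : Prop :=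
  is_projection p /\
  forall u, u^† * u = p -> vn_le (u * u^†) p -> u * u^† = p.

Definition is_factor : Prop :=
  forall x, (forall y, x * y = y * x) -> exists c : R[i], x = c *: 1.

Definition typeIII_factor : Prop :=
  is_factor /\ forall p, finite_projection p -> p = 0.

End Factors.

(** * Morphisms *)

Section Morphisms.
Variables (R : realType) (H K : hilbert R) (A : vnAlg H) (B : vnAlg K).
Implicit Types rho sigma : A -> B.

Definition star_hom rho : Prop :=
  [/\ linear rho, rho 1 = 1, forall a b, rho (a * b) = rho a * rho b
    & forall a, rho a^† = (rho a)^†].

Definition vn_lub (D : set B) (s : B) : Prop :=
  (forall x, D x -> vn_le x s) /\
  forall z, (forall x, D x -> vn_le x z) -> vn_le s z.

Definition directed (D : set B) : Prop :=
  D !=set0 /\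
  forall x y, D x -> D y -> exists z, [/\ D z, vn_le x z & vn_le y z].

Definition normal_map (E : B -> B) : Prop :=
  forall D s, directed D -> vn_lub D s -> vn_lub (E @` D) (E s).

(* Normal conditional expectations from B onto rho(A). *)
Definition cond_expectation rho (E : B -> B) : Prop :=
  [/\ linear E,
      forall x, exists a, E x = rho a,
      forall a x b, E (rho a * x * rho b) = rho a * E x * rho b,
      E 1 = 1 /\ (forall x, vn_pos x -> vn_pos (E x))
    & normal_map E].

(* The index of an expectation E of an infinite factor is the best constant c
   in the Pimsner-Popa bound x <= c E(x) for x >= 0, and the minimal index is
   the minimum of these over E. *)
Definition index_bounds rho : set R :=
  [set c | exists2 E, cond_expectation rho E &
     forall x, vn_pos x -> vn_le x (c%:C *: E x)].

Definition minimal_index rho : R := inf (index_bounds rho).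
Definition stat_dim rho : R := Num.sqrt (minimal_index rho).

Definition is_morphism rho : Prop := star_hom rho /\ index_bounds rho !=set0.

Definition Hom rho sigma : set B :=
  [set t | forall a, t * rho a = sigma a * t].

Definition irreducible rho : Prop :=
  forall t, Hom rho rho t -> exists c : R[i], t = c *: 1.

Definition equivalent rho sigma : Prop :=
  exists2 u, Hom rho sigma u & is_unitary u.

Definition subsector sigma rho : Prop :=
  exists2 t, Hom sigma rho t & is_isometry t.

End Morphisms.

Definition is_conjugate (R : realType) (H K : hilbert R) (A : vnAlg H)
    (B : vnAlg K) (rho : A -> B) (rhobar : B -> A) : Prop :=
  [/\ is_morphism rho, is_morphism rhobar
    & exists (r : A) (rbar : B),
      [/\ Hom id (rhobar \o rho) r /\ is_isometry r,
          Hom id (rho \o rhobar) rbar /\ is_isometry rbar,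
          (rho r)^† * rbar = ((stat_dim rho)^-1)%:C *: 1
        & (rhobar rbar)^† * r = ((stat_dim rho)^-1)%:C *: 1]].

(** * Systems of endomorphisms *)

Section Systems.
Variables (R : realType) (H : hilbert R) (A : vnAlg H).
Implicit Types (Delta : set (A -> A)) (lam mu nu rho : A -> A).

(* lam = \sum_i t_i lam_i(.) t_i^* with t_i isometries obeying the Cuntz
   relations. *)
Definition is_sum n (lams : 'I_n -> A -> A) (t : 'I_n -> A) lam : Prop :=
  [/\ forall i j, (t i)^† * t j = (i == j)%:R,
      \sum_(i < n) t i * (t i)^† = 1
    & forall a, lam a = \sum_(i < n) t i * lams i a * (t i)^†].

Definition Sigma Delta : set (A -> A) :=
  [set lam | exists n (lams : 'I_n -> A -> A) (t : 'I_n -> A),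
     (forall i, Delta (lams i)) /\ is_sum lams t lam].

Definition finite_system Delta : Prop :=
  [/\ finite_set Delta,
      Delta id,
      (forall lam, Delta lam -> is_morphism lam /\ irreducible lam) /\
      (forall lam mu, Delta lam -> Delta mu -> equivalent lam mu -> lam = mu),
      forall lam, Delta lam -> exists2 mu, Delta mu & is_conjugate lam mu
    & forall lam mu, Delta lam -> Delta mu -> Sigma Delta (lam \o mu)].

(* Only the values of eps on Delta are relevant. *)
Definition is_braiding Delta (eps : (A -> A) -> (A -> A) -> A) : Prop :=
  [/\ forall lam mu, Delta lam -> Delta mu ->
        is_unitary (eps lam mu) /\ Hom (lam \o mu) (mu \o lam) (eps lam mu),
      forall lam, Delta lam -> eps id lam = 1 /\ eps lam id = 1
    & forall lam mu nu rho, Delta lam -> Delta mu -> Delta nu -> Delta rho ->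
      forall t, Hom lam (mu \o nu) t ->
      [/\ rho t * eps lam rho = eps mu rho * mu (eps nu rho) * t,
          t * eps rho lam = mu (eps rho nu) * eps rho mu * rho t,
          (rho t)^† * eps mu rho * mu (eps nu rho) = eps lam rho * t^†
        & t^† * mu (eps rho nu) * eps rho mu = eps rho lam * (rho t)^†]].

(* The extension of a braiding to Sigma Delta, computed from some choice of
   decompositions of lam and mu (and 0 outside Sigma Delta). *)
Definition eps_plus Delta eps lam mu : A :=
  xget 0 [set u | exists n (lams : 'I_n -> A -> A) (t : 'I_n -> A)
                         m (mus : 'I_m -> A -> A) (s : 'I_m -> A),
    [/\ forall i, Delta (lams i), is_sum lams t lam,
        forall j, Delta (mus j), is_sum mus s mu
      & u = \sum_(i < n) \sum_(j < m)
              s j * mus j (t i) * eps (lams i) (mus j)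
                * (lams i (s j))^† * (t i)^†]].

Definition eps_minus Delta eps lam mu : A := (eps_plus Delta eps mu lam)^†.

Definition half_braiding (Phi : set (A -> A)) (sigma : A -> A)
    (E : (A -> A) -> A) : Prop :=
  [/\ Sigma Phi sigma,
      forall beta, Phi beta ->
        is_unitary (E beta) /\ Hom (sigma \o beta) (beta \o sigma) (E beta)
    & forall beta1 beta2 beta3, Phi beta1 -> Phi beta2 -> Phi beta3 ->
      forall X, Hom beta3 (beta1 \o beta2) X ->
      X * E beta3 = beta1 (E beta2) * E beta1 * sigma X].

End Systems.

(** * Alpha-induction and the relative braiding *)

Section AlphaInduction.
Variables (R : realType) (H : hilbert R) (N M : vnAlg H).
Variable NM : vn_set N `<=` vn_set M.
Variable iotabar : M -> N.
Variable XN : set (N -> N).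
Variable eps : (N -> N) -> (N -> N) -> N.
Variable XM : set (M -> M).

Let iota : N -> M := vn_incl NM.
Let theta : N -> N := iotabar \o iota.

(* alpha = iotabar^-1 o Ad(e(lam, theta)) o lam o iotabar; iotabar is
   injective, so xget returns the unique preimage. *)
Definition alpha (e : (N -> N) -> (N -> N) -> N) (lam : N -> N) (m : M) : M :=
  xget 0 [set m' | iotabar m' =
                   e lam theta * lam (iotabar m) * (e lam theta)^†].

Definition alpha_plus : (N -> N) -> M -> M := alpha (eps_plus XN eps).
Definition alpha_minus : (N -> N) -> M -> M := alpha (eps_minus XN eps).

(* XM is a choice of representatives of the irreducible subsectors of
   [iota lam iotabar], lam in XN. *)
Definition is_MM_sectors : Prop :=
  [/\ XM id,
      forall beta, XM beta -> [/\ is_morphism beta, irreducible beta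
        & exists2 lam, XN lam & subsector beta (iota \o lam \o iotabar)],
      forall beta beta', XM beta -> XM beta' -> equivalent beta beta' ->
        beta = beta'
    & forall sigma : M -> M, is_morphism sigma -> irreducible sigma ->
        (exists2 lam, XN lam & subsector sigma (iota \o lam \o iotabar)) ->
        exists2 beta, XM beta & equivalent sigma beta].

Definition XM_plus : set (M -> M) :=
  [set beta | XM beta /\ exists2 lam, XN lam & subsector beta (alpha_plus lam)].
Definition XM_minus : set (M -> M) :=
  [set beta | XM beta /\ exists2 lam, XN lam & subsector beta (alpha_minus lam)].
Definition XM_zero : set (M -> M) := XM_plus `&` XM_minus.

Definition rel_braiding_value (beta_p beta_m : M -> M) (u : M) : Prop :=
  exists (lam mu : N -> N) (T S : M),
  [/\ Sigma XN lam /\ Sigma XN mu,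
      Hom beta_p (alpha_plus lam) T /\ is_isometry T,
      Hom beta_m (alpha_minus mu) S /\ is_isometry S
    & u = S^† * (alpha_minus mu T)^† * iota (eps_plus XN eps lam mu)
            * alpha_plus lam S * T].

(* A relative braiding picks, for each pair, one value of the defining formula
   (which does not depend on the choice of lam, mu, T, S). *)
Definition is_rel_braiding (Er : (M -> M) -> (M -> M) -> M) : Prop :=
  forall beta_p beta_m, Sigma XM_plus beta_p -> Sigma XM_minus beta_m ->
    rel_braiding_value beta_p beta_m (Er beta_p beta_m).

End AlphaInduction.

(* Main.v *)
From Pilot Require Import Defs.
From mathcomp Require Import all_boot all_order all_algebra.
From mathcomp Require Import complex.
From mathcomp Require Import all_classical all_reals all_analysis.

Set Implicit Arguments.
Unset Strict Implicit.
Unset Printing Implicit Defensive.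

(* The braiding of XN extends to Sigma XN and is characterised there by
   e(lam,mu) T l(S) = S m(T) eps(l,m) for all T in Hom(l,lam), S in Hom(m,mu)
   with l, m in XN; naturality and the hexagon identities follow.

   If v, w are the isometries of the conjugate pair iota, iotabar, then w^* v is
   a nonzero scalar, so every m in M is iota(n) v with n proportional to
   w^* iotabar(m). Hence alpha_lam is determined by its restriction lam to N and
   by alpha_lam(v) = e(lam,theta)^* v, and e(lam,mu) is natural with respect to
   all intertwiners in M between alpha^+'s, and between alpha^-'s.

   Consequently a value u of the relative braiding satisfies
   alpha^-_mu(T) S u = e(lam,mu) alpha^+_lam(S) T for all lam, mu, T and S, not
   only for those used to compute u. Cancelling isometries in this identity
   gives the half-braiding relations for X_M^+; those for X_M^- follow by
   exchanging the braiding with its opposite, which replaces u by u^*. *)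

Import Order.TTheory GRing.Theory Num.Theory.
(* MathComp has its own [is_unitary], for sesquilinear forms. *)
Import Pilot.Defs.

Local Open Scope classical_set_scope.
Local Open Scope ring_scope.

(** * Adjoints, isometries, star homomorphisms and intertwiners *)

Section StarAlgebra.
Variables (R : realType) (H : hilbert R) (A : vnAlg H).
Implicit Types x y : A.

Lemma vn_starK x : x^†^† = x.
Proof. by apply: val_inj; apply: bopP. Qed.

Lemma vn_starM x y : (x * y)^† = y^† * x^†.
Proof. by apply: val_inj; apply: bopP. Qed.

Lemma vn_star1 : (1 : A)^† = 1.
Proof. by apply: val_inj; apply: bopP. Qed.

Lemma vn_starD x y : (x + y)^† = x^† + y^†.
Proof. by apply: val_inj; apply: bopP => u /=; rewrite !conjC1. Qed.

Lemma vn_star0 : (0 : A)^† = 0.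
Proof. by apply: (addrI (0^†)); rewrite -vn_starD !addr0. Qed.

Lemma vn_star_sum I (s : seq I) (P : pred I) (F : I -> A) :
  (\sum_(i <- s | P i) F i)^† = \sum_(i <- s | P i) (F i)^†.
Proof. by apply: (big_morph _ vn_starD vn_star0). Qed.

(** Turns an identity between products into a rewriting rule that applies inside a longer
    right-nested product. *)
Lemma mulr_eqA (a b c : A) : a * b = c -> forall x, a * (b * x) = c * x.
Proof. by move=> <- x; rewrite mulrA. Qed.

Lemma mulr_eqA3 (a b c d : A) : a * b * c = d -> forall x, a * (b * (c * x)) = d * x.
Proof. by move=> <- x; rewrite !mulrA. Qed.

Lemma isometryI (u x y : A) : is_isometry u -> u * x = u * y -> x = y.
Proof. by move=> uu e; rewrite -[x]mul1r -uu -mulrA e mulrA uu mul1r. Qed.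

Lemma unitary_isometry (u : A) : is_unitary u -> is_isometry u.
Proof. by case. Qed.

Lemma isometryM (u v : A) : is_isometry u -> is_isometry v -> is_isometry (u * v).
Proof. by move=> uu vv; rewrite /is_isometry vn_starM mulrA -(mulrA v^†) uu mulr1. Qed.

Lemma unitary_star (u : A) : is_unitary u -> is_unitary u^†.
Proof. by case=> uu vv; split; rewrite vn_starK. Qed.

End StarAlgebra.

Section Homomorphisms.
Variables (R : realType) (H K : hilbert R) (A : vnAlg H) (B : vnAlg K).
Variables (rho : A -> B) (rhoH : star_hom rho).

Lemma star_homD a b : rho (a + b) = rho a + rho b.
Proof. by case: rhoH => rl _ _ _; move: (rl 1 a b); rewrite !scale1r. Qed.

Lemma star_hom0 : rho 0 = 0.
Proof. by apply: (addrI (rho 0)); rewrite -star_homD !addr0. Qed.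

Lemma star_hom1 : rho 1 = 1.
Proof. by case: rhoH. Qed.

Lemma star_homM a b : rho (a * b) = rho a * rho b.
Proof. by case: rhoH. Qed.

Lemma star_homS a : rho a^† = (rho a)^†.
Proof. by case: rhoH. Qed.

Lemma star_hom_sum I (s : seq I) (P : pred I) (F : I -> A) :
  rho (\sum_(i <- s | P i) F i) = \sum_(i <- s | P i) rho (F i).
Proof. by apply: (big_morph _ star_homD star_hom0). Qed.

Lemma star_hom_isometry u : is_isometry u -> is_isometry (rho u).
Proof. by move=> uu; rewrite /is_isometry -star_homS -star_homM uu star_hom1. Qed.

Lemma star_hom_unitary u : is_unitary u -> is_unitary (rho u).
Proof. by case=> u1 u2; split; rewrite -star_homS -star_homM ?u1 ?u2 star_hom1. Qed.

End Homomorphisms.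

Lemma star_hom_comp (R : realType) (H K L : hilbert R) (A : vnAlg H) (B : vnAlg K)
    (C : vnAlg L) (f : B -> C) (g : A -> B) :
  star_hom f -> star_hom g -> star_hom (f \o g).
Proof.
move=> [f1 f2 f3 f4] [g1 g2 g3 g4]; split=> [c a b||a b|a] /=.
- by rewrite g1 f1.
- by rewrite g2.
- by rewrite g3.
- by rewrite g4.
Qed.

Section HomSpaces.
Variables (R : realType) (H K : hilbert R) (A : vnAlg H) (B : vnAlg K).
Implicit Types rho sigma tau : A -> B.

Lemma Hom_star rho sigma t : star_hom rho -> star_hom sigma ->
  Hom rho sigma t -> Hom sigma rho t^†.
Proof.
move=> hr hs ht a; have := congr1 (@vn_star _ _ _) (ht a^†).
by rewrite !vn_starM (star_homS hr) (star_homS hs) !vn_starK.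
Qed.

Lemma HomM rho sigma tau s t : Hom sigma tau s -> Hom rho sigma t ->
  Hom rho tau (s * t).
Proof. by move=> hs ht a; rewrite -mulrA ht mulrA hs mulrA. Qed.

End HomSpaces.

(** * Direct sums of endomorphisms; closure of Sigma under sums and products *)

Section Sums.
Variables (R : realType) (H : hilbert R) (A : vnAlg H) (Delta : set (A -> A)).
Hypothesis DeltaH : forall lam, Delta lam -> star_hom lam.

(** Arbitrary finite index types replace ordinals here, so that iterated sums can be indexed by
    pairs and dependent pairs. *)
Definition fin_sum (I : finType) (lams : I -> A -> A) (t : I -> A) lam : Prop :=
  [/\ forall i j, (t i)^† * t j = (i == j)%:R,
      \sum_i t i * (t i)^† = 1
    & forall a, lam a = \sum_i t i * lams i a * (t i)^†].

Lemma fin_sum_Hom (I : finType) (lams : I -> A -> A) t lam j :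
  fin_sum lams t lam -> Hom (lams j) lam (t j).
Proof.
move=> [tt _ lE] a; rewrite lE mulr_suml (bigD1 j)//= big1 ?addr0 => [|i ij].
  by rewrite -mulrA tt eqxx mulr1.
by rewrite -mulrA tt (negPf ij) mulr0.
Qed.

Lemma fin_sum_star_hom (I : finType) (lams : I -> A -> A) t lam :
  (forall i, star_hom (lams i)) -> fin_sum lams t lam -> star_hom lam.
Proof.
move=> lH lS; have [tt t1 lE] := lS; split=> [c a b||a b|a].
- rewrite !lE scaler_sumr -big_split /=; apply: eq_bigr => i _.
  by have [-> _ _ _] := lH i; rewrite mulrDr mulrDl -scalerAr -scalerAl.
- by rewrite lE -[RHS]t1; apply: eq_bigr => i _; rewrite (star_hom1 (lH i)) mulr1.
- rewrite [lam b]lE mulr_sumr lE; apply: eq_bigr => i _.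
  by rewrite (star_homM (lH i)) !mulrA (fin_sum_Hom i lS).
- rewrite !lE vn_star_sum; apply: eq_bigr => i _.
  by rewrite !vn_starM vn_starK (star_homS (lH i)) mulrA.
Qed.

Lemma Sigma_fin_sum (I : finType) (lams : I -> A -> A) t lam :
  (forall i, Delta (lams i)) -> fin_sum lams t lam -> Sigma Delta lam.
Proof.
move=> lD [tt t1 lE].
have bij : {on predT, bijective (@enum_val I predT)}.
  by apply: onW_bij; apply: enum_val_bij.
exists #|I|, (lams \o enum_val), (t \o enum_val); split=> [i|]; first exact: lD.
split=> [i j||a] /=.
- by rewrite tt (inj_eq enum_val_inj).
- by rewrite -[RHS]t1 (reindex _ bij).
- by rewrite lE (reindex _ bij).
Qed.

Lemma Sigma_sub Delta' lam : Delta `<=` Delta' -> Sigma Delta lam -> Sigma Delta' lam.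
Proof.
by move=> sub [n [lams [t [lD lS]]]]; exists n, lams, t; split=> // i; apply: sub.
Qed.

Lemma Sigma_id lam : Delta lam -> Sigma Delta lam.
Proof.
move=> Dl; exists 1%N, (fun=> lam), (fun=> 1); split=> //.
split=> [i j||a]; rewrite ?big_ord1 ?vn_star1 ?mul1r ?mulr1//.
by rewrite !ord1.
Qed.

Lemma Sigma_star_hom lam : Sigma Delta lam -> star_hom lam.
Proof. by move=> [n [lams [t [lD lS]]]]; apply: fin_sum_star_hom lS => i; apply: DeltaH. Qed.

(** Nested decompositions flatten: the isometries are the products [t i * s i k]. The number of
    summands of [lams i] depends on [i], hence the dependent pairs as index set. *)
Lemma Sigma_Sigma (I : finType) (lams : I -> A -> A) t lam :
  (forall i, Sigma Delta (lams i)) -> fin_sum lams t lam -> Sigma Delta lam.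
Proof.
move=> lD [tt t1 lE].
pose n i := projT1 (cid (lD i)).
pose mus i : 'I_(n i) -> A -> A := projT1 (cid (projT2 (cid (lD i)))).
pose s i : 'I_(n i) -> A := projT1 (cid (projT2 (cid (projT2 (cid (lD i)))))).
have musP i : (forall j, Delta (mus i j)) /\ is_sum (mus i) (s i) (lams i).
  exact: (projT2 (cid (projT2 (cid (projT2 (cid (lD i))))))).
apply: (@Sigma_fin_sum {i : I & 'I_(n i)} (fun p => mus (tag p) (tagged p))
  (fun p => t (tag p) * s (tag p) (tagged p))) => [p|].
  by have [] := musP (tag p).
split=> [[i k] [j l]||a] /=.
- rewrite vn_starM mulrA -(mulrA (s i k)^†) tt.
  have [ij|ij] := eqVneq i j; last first.
    rewrite mulr0 mul0r; case: eqP => // e.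
    by move: ij; rewrite (congr1 tag e : i = j) eqxx.
  subst j; rewrite mulr1; have [_ [-> _ _]] := musP i.
  by rewrite (@eq_Tagged I (fun i => 'I_(n i)) (existT _ i k) l).
- rewrite -[RHS]t1.
  rewrite -(@sig_big_dep _ _ _ I (fun i => 'I_(n i)) predT (fun _ => predT)
    (fun i k => t i * s i k * (t i * s i k)^†)) /=.
  apply: eq_bigr => i _; have [_ [_ s1 _]] := musP i.
  rewrite -[X in _ = X * _]mulr1 -s1 mulr_sumr mulr_suml; apply: eq_bigr => k _.
  by rewrite vn_starM !mulrA.
- rewrite lE -(@sig_big_dep _ _ _ I (fun i => 'I_(n i)) predT (fun _ => predT)
    (fun i k => t i * s i k * mus i k a * (t i * s i k)^†)) /=.
  apply: eq_bigr => i _; have [_ [_ _ ->]] := musP i.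
  rewrite mulr_sumr mulr_suml; apply: eq_bigr => k _.
  by rewrite vn_starM !mulrA.
Qed.

Hypothesis DeltaM : forall lam mu, Delta lam -> Delta mu -> Sigma Delta (lam \o mu).

(** The isometries [t i * lams i (s j)] decompose the composite into the products of the summands,
    which lie in Sigma by [DeltaM]; [Sigma_Sigma] then flattens the result. *)
Lemma Sigma_comp lam mu : Sigma Delta lam -> Sigma Delta mu -> Sigma Delta (lam \o mu).
Proof.
move=> [n [lams [t [lD [tt t1 lE]]]]] [m [mus [s [mD [ss s1 mE]]]]].
have lH i := DeltaH (lD i).
apply: (@Sigma_Sigma ('I_n * 'I_m)%type (fun p => lams p.1 \o mus p.2)
  (fun p => t p.1 * lams p.1 (s p.2))) => [p|]; first exact: DeltaM.
split=> [[i k] [j l]||a] /=.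
- rewrite vn_starM mulrA -(mulrA (lams i _)^†) tt xpair_eqE.
  have [ij|ij] := eqVneq i j; last by rewrite mulr0 mul0r.
  subst j; rewrite mulr1 -(star_homS (lH i)) -(star_homM (lH i)) ss.
  by case: eqP => _; rewrite ?(star_hom1 (lH i)) ?(star_hom0 (lH i)).
- rewrite -(pair_bigA _ (fun i j => t i * lams i (s j) * (t i * lams i (s j))^†)) /=.
  rewrite -[RHS]t1; apply: eq_bigr => i _.
  rewrite -[X in _ = X * _]mulr1 -(star_hom1 (lH i)) -s1 (star_hom_sum (lH i)).
  rewrite mulr_sumr mulr_suml; apply: eq_bigr => k _.
  by rewrite vn_starM (star_homM (lH i)) (star_homS (lH i)) !mulrA.
- rewrite -(pair_bigA _ (fun i j => t i * lams i (s j) * lams i (mus j a) *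
    (t i * lams i (s j))^†)) /=.
  rewrite lE; apply: eq_bigr => i _; rewrite mE (star_hom_sum (lH i)) mulr_sumr mulr_suml.
  apply: eq_bigr => k _.
  by rewrite vn_starM !(star_homM (lH i)) (star_homS (lH i)) !mulrA.
Qed.

End Sums.

(** * Braidings on sets of endomorphisms closed under composition *)

Section BraidedSets.
Variables (R : realType) (H : hilbert R) (A : vnAlg H).
Implicit Types (Sg : set (A -> A)) (e : (A -> A) -> (A -> A) -> A).

(** Naturality in both arguments and the two hexagons, for an abstract [e], so that a braiding and
    its opposite are treated alike. *)
Record braided Sg e : Prop := Braided {
  braided_star_hom : forall lam, Sg lam -> star_hom lam;
  braided_comp : forall lam mu, Sg lam -> Sg mu -> Sg (lam \o mu);
  braided_unitary : forall lam mu, Sg lam -> Sg mu -> is_unitary (e lam mu);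
  braided_Hom : forall lam mu, Sg lam -> Sg mu ->
    Hom (lam \o mu) (mu \o lam) (e lam mu);
  braided_natl : forall lam mu rho t, Sg lam -> Sg mu -> Sg rho ->
    Hom lam mu t -> rho t * e lam rho = e mu rho * t;
  braided_natr : forall lam mu rho t, Sg lam -> Sg mu -> Sg rho ->
    Hom lam mu t -> t * e rho lam = e rho mu * rho t;
  braided_compl : forall lam mu rho, Sg lam -> Sg mu -> Sg rho ->
    e (lam \o mu) rho = e lam rho * lam (e mu rho);
  braided_compr : forall lam mu rho, Sg lam -> Sg mu -> Sg rho ->
    e rho (lam \o mu) = lam (e rho mu) * e rho lam }.

(** Taking adjoints interchanges the two naturality laws and the two hexagons; unitarity moves the
    braiding operators to the other side. *)
Lemma braided_opp Sg e e' : braided Sg e ->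
  (forall lam mu, e' lam mu = (e mu lam)^†) -> braided Sg e'.
Proof.
move=> b e'E; have bH := braided_star_hom b.
have bU := braided_unitary b; split=> //; first exact: braided_comp b.
- by move=> lam mu hl hm; rewrite e'E; apply/unitary_star/bU.
- move=> lam mu hl hm; rewrite e'E; apply: Hom_star; last exact: braided_Hom b _ _ _ _.
  + by apply: star_hom_comp; apply: bH.
  + by apply: star_hom_comp; apply: bH.
- move=> lam mu rho t hl hm hr ht; rewrite !e'E.
  apply: (isometryI (unitary_isometry (bU _ _ hr hm))).
  by rewrite mulrA -(braided_natr b hl hm hr ht) -mulrA (bU _ _ hr hl).2
    mulr1 mulrA (bU _ _ hr hm).2 mul1r.
- move=> lam mu rho t hl hm hr ht; rewrite !e'E.
  apply: (isometryI (unitary_isometry (bU _ _ hm hr))).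
  by rewrite mulrA -(braided_natl b hl hm hr ht) -mulrA (bU _ _ hl hr).2
    mulr1 mulrA (bU _ _ hm hr).2 mul1r.
- move=> lam mu rho hl hm hr; rewrite !e'E.
  by rewrite (braided_compr b hl hm hr) vn_starM (star_homS (bH _ hl)).
- move=> lam mu rho hl hm hr; rewrite !e'E.
  by rewrite (braided_compl b hl hm hr) vn_starM (star_homS (bH _ hl)).
Qed.

End BraidedSets.

(** * Extension of a braiding from the system to its finite sums *)

Section BraidingExtension.
Variables (R : realType) (H : hilbert R) (A : vnAlg H) (Delta : set (A -> A)).
Variable eps : (A -> A) -> (A -> A) -> A.
Hypothesis DeltaH : forall lam, Delta lam -> star_hom lam.
Hypothesis DeltaM : forall lam mu, Delta lam -> Delta mu -> Sigma Delta (lam \o mu).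
Hypothesis Delta1 : Delta id.
Hypothesis epsP : is_braiding Delta eps.
Implicit Types lam mu nu rho l m n r : A -> A.

Let epsH l m : Delta l -> Delta m -> Hom (l \o m) (m \o l) (eps l m).
Proof. by case: epsP => h _ _ Dl Dm; case: (h _ _ Dl Dm). Qed.

Let epsU l m : Delta l -> Delta m -> is_unitary (eps l m).
Proof. by case: epsP => h _ _ Dl Dm; case: (h _ _ Dl Dm). Qed.

(** The braiding axiom with one factor of the product equal to [id], where [eps] is 1. *)
Let eps_natl l m r t : Delta l -> Delta m -> Delta r -> Hom l m t ->
  r t * eps l r = eps m r * t.
Proof.
case: epsP => _ h1 h Dl Dm Dr ht.
have [-> _ _ _] := h _ _ _ _ Dl Dm Delta1 Dr t ht.
by rewrite (h1 _ Dr).1 (star_hom1 (DeltaH Dm)) mulr1.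
Qed.

Let eps_natr l m r t : Delta l -> Delta m -> Delta r -> Hom l m t ->
  t * eps r l = eps r m * r t.
Proof.
case: epsP => _ h1 h Dl Dm Dr ht.
have [_ -> _ _] := h _ _ _ _ Dl Dm Delta1 Dr t ht.
by rewrite (h1 _ Dr).2 (star_hom1 (DeltaH Dm)) mul1r.
Qed.

(* Since the products T l(S) span the unit of A, this condition determines u;
   unlike the defining sum, it does not refer to decompositions. *)
Definition braid_ext lam mu (u : A) : Prop :=
  forall l m T S, Delta l -> Delta m -> Hom l lam T -> Hom m mu S ->
    u * T * l S = S * m T * eps l m.

Lemma SigmaH lam : Sigma Delta lam -> star_hom lam.
Proof. exact: Sigma_star_hom. Qed.

(** Whichever decompositions [xget] selects, naturality of [eps] under [(t i)^† * T] and
    [(s j)^† * S] gives the characterising identity. The default 0 does not occur, since both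
    arguments lie in Sigma. *)
Lemma eps_plusP lam mu : Sigma Delta lam -> Sigma Delta mu ->
  braid_ext lam mu (eps_plus Delta eps lam mu).
Proof.
move=> Sl Sm; rewrite /eps_plus.
set P := [set u | _]; have : P (xget 0 P).
  apply: xgetPex; have [n [lams [t [lD lS]]]] := Sl.
  have [m [mus [s [mD mS]]]] := Sm.
  by eexists; exists n, lams, t, m, mus, s.
move: (xget 0 P) => u [n [lams [t [m [mus [s [lD lS mD mS ->]]]]]]].
have lH := SigmaH Sl; have mH := SigmaH Sm.
move=> l r T S Dl Dr hT hS.
have [_ t1 _] := lS; have [_ s1 _] := mS.
(* The right-hand side is expanded by inserting the two resolutions of the unit in front of S and T;
   the sums are then compared term by term. *)
transitivity (\sum_(i < n) \sum_(j < m)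
  s j * (s j)^† * S * r (t i * (t i)^† * T) * eps l r); last first.
  rewrite exchange_big /= -[in RHS](mul1r S) -s1 !mulr_suml; apply: eq_bigr => j _.
  rewrite -[in RHS](mul1r T) -t1 mulr_suml (star_hom_sum (DeltaH Dr)) mulr_sumr mulr_suml.
  by apply: eq_bigr => i _.
rewrite !mulr_suml; apply: eq_bigr => i _; rewrite !mulr_suml; apply: eq_bigr => j _.
have hi : Hom l (lams i) ((t i)^† * T).
  apply: HomM hT; apply: Hom_star; [exact: DeltaH|exact: lH|exact: fin_sum_Hom lS].
have hj : Hom r (mus j) ((s j)^† * S).
  apply: HomM hS; apply: Hom_star; [exact: DeltaH|exact: mH|exact: fin_sum_Hom mS].
have lsH := DeltaH (lD i); have msH := DeltaH (mD j).
set a := (t i)^† * T in hi *; set b := (s j)^† * S in hj *.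
have e1 : (lams i (s j))^† * ((t i)^† * (T * l S)) = a * l b.
  by rewrite (star_homM (DeltaH Dl)) [RHS]mulrA hi (star_homS lsH) /a -!mulrA.
rewrite -!mulrA -/a; congr (_ * _).
rewrite e1 (mulr_eqA (esym (eps_natl Dl (lD i) (mD j) hi))) -mulrA.
rewrite -(eps_natr Dr (mD j) Dl hj) (star_homM (DeltaH Dr)).
by rewrite (mulr_eqA (esym (hj a))) -mulrA (mulr_eqA (esym (hj (t i)))) /b !mulrA.
Qed.

(** The elements [t i * lams i (s j)] resolve the unit, and each has the form T l(S). *)
Lemma braid_ext_inj lam mu u v : Sigma Delta lam -> Sigma Delta mu ->
  (forall l m T S, Delta l -> Delta m -> Hom l lam T -> Hom m mu S ->
    u * T * l S = v * T * l S) -> u = v.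
Proof.
move=> [n [lams [t [lD lS]]]] [m [mus [s [mD mS]]]] uv.
have [_ t1 _] := lS; have [_ s1 _] := mS.
have E w : w = \sum_(i < n) \sum_(j < m) w * t i * lams i (s j) * (lams i (s j))^† * (t i)^†.
  rewrite -[LHS]mulr1 -t1 mulr_sumr; apply: eq_bigr => i _.
  have lsH := DeltaH (lD i).
  rewrite -[X in w * (X * _)]mulr1 -(star_hom1 lsH) -s1 (star_hom_sum lsH).
  rewrite mulr_sumr mulr_suml mulr_sumr; apply: eq_bigr => j _.
  by rewrite (star_homM lsH) (star_homS lsH) !mulrA.
rewrite (E u) (E v); apply: eq_bigr => i _; apply: eq_bigr => j _.
by rewrite (uv _ (mus j))//; [exact: fin_sum_Hom lS|exact: fin_sum_Hom mS].
Qed.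

(** Inserting the same resolution of the unit splits [y] into terms T l(S) x with x an intertwiner
    between members of Delta. This reduces the hexagons to the axioms for [eps]. *)
Lemma Hom_comp_ind lam mu r (P : A -> Prop) :
  Sigma Delta lam -> Sigma Delta mu -> Delta r ->
  P 0 -> (forall x y, P x -> P y -> P (x + y)) ->
  (forall l m T S x, Delta l -> Delta m -> Hom l lam T -> Hom m mu S ->
     Hom r (l \o m) x -> P (T * l S * x)) ->
  forall y, Hom r (lam \o mu) y -> P y.
Proof.
move=> Sl Sm Dr P0 PD PE y hy.
have lH := SigmaH Sl; have mH := SigmaH Sm.
have [n [lams [t [lD lS]]]] := Sl; have [m [mus [s [mD mS]]]] := Sm.
have [_ t1 _] := lS; have [_ s1 _] := mS.
have -> : y = \sum_(i < n) \sum_(j < m)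
    t i * lams i (s j) * ((lams i (s j))^† * (t i)^† * y).
  rewrite -[LHS]mul1r -t1 mulr_suml; apply: eq_bigr => i _.
  have lsH := DeltaH (lD i).
  rewrite -[X in X * _ * _]mulr1 -(star_hom1 lsH) -s1 (star_hom_sum lsH).
  rewrite mulr_sumr !mulr_suml; apply: eq_bigr => j _.
  by rewrite (star_homM lsH) (star_homS lsH) !mulrA.
apply: (big_ind P) => // i _; apply: (big_ind P) => // j _.
have lsH := DeltaH (lD i); have msH := DeltaH (mD j).
apply: (PE _ (mus j)) => //; [exact: fin_sum_Hom lS|exact: fin_sum_Hom mS|].
have h1 : Hom (lam \o mu) (lams i \o mu) (t i)^†.
  by move=> a; apply: (Hom_star lsH lH); apply: fin_sum_Hom lS.
have h2 : Hom (lams i \o mu) (lams i \o mus j) (lams i (s j))^†.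
  move=> a; rewrite /= -(star_homS lsH) -!(star_homM lsH); congr (lams i _).
  by apply: (Hom_star msH mH); apply: fin_sum_Hom mS.
exact: HomM (HomM h2 h1) hy.
Qed.

Local Notation e := (eps_plus Delta eps).

Lemma eps_plus_unitary lam mu : Sigma Delta lam -> Sigma Delta mu ->
  is_unitary (e lam mu).
Proof.
move=> Sl Sm; have lH := SigmaH Sl; have mH := SigmaH Sm.
have eP := eps_plusP Sl Sm; set u := e lam mu in eP *.
(* Left multiplication by [u] preserves the A-valued inner products of the spanning elements T
   l(S). *)
have inner l m T S l' m' T' S' : Delta l -> Delta m -> Hom l lam T -> Hom m mu S ->
    Delta l' -> Delta m' -> Hom l' lam T' -> Hom m' mu S' ->
    (u * T' * l' S')^† * (u * T * l S) = (T' * l' S')^† * (T * l S).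
  move=> Dl Dm hT hS Dl' Dm' hT' hS'.
  have ha : Hom l l' (T'^† * T) by apply: HomM hT; apply: Hom_star hT'; [exact: DeltaH|].
  have hb : Hom m m' (S'^† * S) by apply: HomM hS; apply: Hom_star hS'; [exact: DeltaH|].
  rewrite (eP _ _ _ _ Dl Dm hT hS) (eP _ _ _ _ Dl' Dm' hT' hS') !vn_starM.
  rewrite -(star_homS (DeltaH Dm')) -(star_homS (DeltaH Dl')) -!mulrA.
  rewrite [S'^† * _]mulrA (mulr_eqA (esym (hb _))) -!mulrA.
  rewrite (mulr_eqA (esym (star_homM (DeltaH Dm) _ _))) (eps_natl Dl Dl' Dm ha).
  rewrite [S'^† * _]mulrA (mulr_eqA (eps_natr Dm Dm' Dl' hb)) -!mulrA.
  rewrite (mulr_eqA (epsU Dl' Dm').1) mul1r (star_homM (DeltaH Dl')) -!mulrA; congr (_ * _).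
  by rewrite [RHS]mulrA ha.
have uu : u^† * u = 1.
  (* The spanning elements are used on both sides, the second time after taking adjoints, to reach
     the form of [inner]. *)
  apply: (braid_ext_inj Sl Sm) => l m T S Dl Dm hT hS; rewrite mul1r.
  apply: (can_inj (@vn_starK _ _ A)); apply: (braid_ext_inj Sl Sm) => l' m' T' S' Dl' Dm' hT' hS'.
  apply: (can_inj (@vn_starK _ _ A)); move: (inner _ _ _ _ _ _ _ _ Dl Dm hT hS Dl' Dm' hT' hS').
  by rewrite !vn_starM !vn_starK -!mulrA.
split=> //; apply: (braid_ext_inj Sm Sl) => m l S T Dm Dl hS hT.
have [_ eV] := epsU Dl Dm.
(* Each S m(T) lies in the range of [u], hence is fixed by [u * u^†]; these elements span for the
   pair (mu, lam). *)
have E : S * m T = u * T * l S * (eps l m)^†.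
  by rewrite (eP _ _ _ _ Dl Dm hT hS) -mulrA eV mulr1.
by rewrite -!mulrA E mul1r -!mulrA (mulr_eqA uu) mul1r.
Qed.

Lemma eps_plus_braided : braided (Sigma Delta) e.
Proof.
split.
- exact: SigmaH.
- exact: Sigma_comp.
- exact: eps_plus_unitary.
- move=> lam mu Sl Sm a; have lH := SigmaH Sl; have mH := SigmaH Sm.
  apply: (braid_ext_inj Sl Sm) => l m T S Dl Dm hT hS /=.
  rewrite -(mulrA _ _ T) -[lam (mu a) * T]hT mulrA -mulrA -(star_homM (DeltaH Dl)) -[mu a * S]hS.
  rewrite (star_homM (DeltaH Dl)) mulrA (eps_plusP Sl Sm Dl Dm hT hS).
  rewrite -mulrA [eps l m * _](epsH Dl Dm) /= mulrA -(mulrA _ (m T)) -(star_homM (DeltaH Dm)) hT.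
  rewrite (star_homM (DeltaH Dm)) !mulrA hS -(mulrA _ S) -(mulrA _ (S * _)).
  by rewrite -(eps_plusP Sl Sm Dl Dm hT hS) !mulrA.
- move=> lam mu rho t Sl Sm Sr ht.
  apply: (braid_ext_inj Sl Sr) => l r T S Dl Dr hT hS.
  rewrite -!mulrA [e lam rho * _]mulrA (eps_plusP Sl Sr Dl Dr hT hS).
  have := eps_plusP Sm Sr Dl Dr (HomM ht hT) hS; rewrite (star_homM (DeltaH Dr)) -!mulrA => ->.
  by rewrite [LHS]mulrA -hS -!mulrA.
- move=> lam mu rho t Sl Sm Sr ht; have rH := SigmaH Sr.
  apply: (braid_ext_inj Sr Sl) => r l T S Dr Dl hT hS.
  rewrite -[LHS]mulrA -[LHS]mulrA [e rho lam * _]mulrA (eps_plusP Sr Sl Dr Dl hT hS).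
  have := eps_plusP Sr Sm Dr Dl hT (HomM ht hS); rewrite (star_homM (DeltaH Dr)) !mulrA => <-.
  by rewrite -(mulrA _ _ T) -hT !mulrA.
- move=> lam mu rho Sl Sm Sr; have lH := SigmaH Sl.
  apply: (braid_ext_inj (Sigma_comp DeltaH DeltaM Sl Sm) Sr) => q r y S Dq Dr hy hS.
  rewrite (eps_plusP (Sigma_comp DeltaH DeltaM Sl Sm) Sr Dq Dr hy hS); apply/esym.
  move: y hy; apply: (Hom_comp_ind Sl Sm Dq).
  + by rewrite (star_hom0 (DeltaH Dr)) !(mulr0, mul0r).
  + by move=> x y hx hy; rewrite (star_homD (DeltaH Dr)) !(mulrDr, mulrDl) hx hy.
  + move=> l m T S' x Dl Dm hT hS' hx.
    have [_ _ /(_ _ _ _ _ Dq Dl Dm Dr x hx) [d1 _ _ _]] := epsP.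
    have lH' := DeltaH Dl; have rH := DeltaH Dr.
    rewrite -!mulrA [x * _]hx /= (mulr_eqA (esym (hT _))).
    rewrite -!mulrA !(mulr_eqA (esym (star_homM lH' _ _))).
    rewrite (eps_plusP Sm Sr Dm Dr hS' hS) !(star_homM lH') -!mulrA.
    rewrite (mulr_eqA3 (eps_plusP Sl Sr Dl Dr hT hS)) -!mulrA.
    rewrite (mulr_eqA (epsH Dl Dr S' : _ * l (r S') = r (l S') * _)) -!mulrA.
    by rewrite !(star_homM rH) -!mulrA d1 -!mulrA.
- move=> lam mu rho Sl Sm Sr; have lH := SigmaH Sl.
  apply: (braid_ext_inj Sr (Sigma_comp DeltaH DeltaM Sl Sm)) => r q T y Dr Dq hT hy.
  rewrite (eps_plusP Sr (Sigma_comp DeltaH DeltaM Sl Sm) Dr Dq hT hy); apply/esym.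
  move: y hy; apply: (Hom_comp_ind Sl Sm Dq).
  + by rewrite (star_hom0 (DeltaH Dr)) !(mulr0, mul0r).
  + by move=> x y hx hy; rewrite (star_homD (DeltaH Dr)) !(mulrDr, mulrDl) hx hy.
  + move=> l m T1 S x Dl Dm hT1 hS hx.
    have [_ _ /(_ _ _ _ _ Dq Dl Dm Dr x hx) [_ d2 _ _]] := epsP.
    have lH' := DeltaH Dl; have rH := DeltaH Dr.
    rewrite !(star_homM rH) -!mulrA.
    rewrite (mulr_eqA3 (eps_plusP Sr Sl Dr Dl hT hT1)) -!mulrA.
    rewrite (mulr_eqA (epsH Dr Dl S : _ * r (l S) = l (r S) * _)) (mulr_eqA (esym (hT1 _))) -!mulrA.
    rewrite !(mulr_eqA (esym (star_homM lH' _ _))) (eps_plusP Sr Sm Dr Dm hT hS).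
    rewrite !(star_homM lH') (mulr_eqA (hx T : x * q T = l (m T) * x)) -!mulrA.
    by rewrite d2 -!mulrA.
Qed.

End BraidingExtension.

(** * Alpha-induction, computed through the conjugate pair *)

Section AlphaInduction.
Variables (R : realType) (H : hilbert R) (N M : vnAlg H).
Variable NM : vn_set N `<=` vn_set M.
Variable iotabar : M -> N.
Local Notation iota := (vn_incl NM).
Local Notation theta := (iotabar \o iota).
Hypotheses (ioH : star_hom iota) (ibH : star_hom iotabar).
Variables (w : N) (v : M) (c : R[i]).
Hypotheses (wP : @Hom _ _ _ N N id theta w)
  (vP : @Hom _ _ _ M M id (iota \o iotabar) v).
Hypotheses (vI : is_isometry v) (c0 : c != 0) (wv : (iota w)^† * v = c *: 1).
Variable Sg : set (N -> N).
Hypothesis SgT : Sg theta.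

Lemma iotabar_inj : injective iotabar.
Proof. by move=> x y xy; apply: (isometryI vI); rewrite !vP /= xy. Qed.

Definition coef (m : M) : N := c^-1 *: (w^† * iotabar m).

Lemma coefE m : m = iota (coef m) * v.
Proof.
have [iol _ _ _] := ioH; have := iol c^-1 (w^† * iotabar m) 0.
rewrite (star_hom0 ioH) !addr0 /coef => ->.
rewrite (star_homM ioH) (star_homS ioH) -scalerAl -mulrA.
by rewrite -[iota _ * v]vP mulrA wv -scalerAl scalerA mulVf// scale1r mul1r.
Qed.

(** An intertwiner in M becomes one in N at the cost of a factor theta in the source, so naturality
    in N can be applied to it. *)
Lemma coef_Hom (lam mu : N -> N) (t : M) : (forall a, t * iota (lam a) = iota (mu a) * t) ->
  Hom (theta \o lam) mu (coef t).
Proof.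
move=> ht a; rewrite /coef -scalerAl -scalerAr -mulrA -(star_homM ibH) ht.
rewrite (star_homM ibH) !mulrA; congr (_ *: (_ * _)).
by apply: (can_inj (@vn_starK _ _ N)); rewrite !vn_starM vn_starK
  -(star_homS ibH) -(star_homS ioH) wP.
Qed.

Section OneBraiding.
Variable e : (N -> N) -> (N -> N) -> N.
Hypothesis eB : braided Sg e.
Local Notation al := (alpha NM iotabar e).

Let thetaH : star_hom theta := star_hom_comp ibH ioH.

(** Up to a scalar, [iotabar v] is the comultiplication of the Q-system carried by theta. *)
Lemma theta_v : Hom theta (theta \o theta) (iotabar v).
Proof. by move=> a; rewrite /= -!(star_homM ibH) vP. Qed.

(** Naturality under [theta_v] combined with the hexagon for theta theta; the unitary
    theta(e(lam,theta)) is then cancelled. *)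
Lemma braid_iotabar_v lam : Sg lam ->
  e lam theta * lam (iotabar v) * (e lam theta)^† =
  theta (e lam theta)^† * iotabar v.
Proof.
move=> Sl; have thH := thetaH; have eU := braided_unitary eB Sl SgT.
have := braided_natr eB SgT (braided_comp eB SgT SgT) Sl theta_v.
rewrite (braided_compr eB SgT SgT Sl) -mulrA => h.
apply: (isometryI (star_hom_isometry thH (unitary_isometry eU))).
rewrite [LHS]mulrA -h -mulrA eU.2 mulr1.
by rewrite mulrA -(star_homM thH) eU.2 (star_hom1 thH) mul1r.
Qed.

(** Exhibits the preimage under [iotabar] that [alpha] asks for, so the default value of [xget]
    never occurs. Its form comes from writing m as iota(n) v. *)
Lemma alpha_witness lam m : Sg lam ->
  iotabar (iota (lam (coef m)) * (iota (e lam theta)^† * v)) =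
  e lam theta * lam (iotabar m) * (e lam theta)^†.
Proof.
move=> Sl; have lH := braided_star_hom eB Sl.
have eH a : e lam theta * lam (iotabar (iota a)) = iotabar (iota (lam a)) * e lam theta.
  exact: (braided_Hom eB Sl SgT).
rewrite [in RHS](coefE m) !(star_homM ibH) (star_homM lH) -!mulrA (mulr_eqA (eH _)).
by rewrite -!mulrA [e lam theta * _]mulrA braid_iotabar_v.
Qed.

Lemma alphaE lam m : Sg lam ->
  iotabar (al lam m) = e lam theta * lam (iotabar m) * (e lam theta)^†.
Proof.
move=> Sl; rewrite /alpha; set P := [set _ | _]; have : P (xget 0 P) => [|->//].
by apply: xgetPex; eexists; exact: alpha_witness.
Qed.

Lemma alpha_star_hom lam : Sg lam -> star_hom (al lam).
Proof.
move=> Sl; have lH := braided_star_hom eB Sl.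
have [e1 e2] := braided_unitary eB Sl SgT.
have [il _ _ _] := ibH; have [ll _ _ _] := lH.
split=> [a x y||x y|x]; apply: iotabar_inj.
- by rewrite !il !alphaE// il ll mulrDr mulrDl -scalerAr -scalerAl.
- by rewrite alphaE// !(star_hom1 ibH) (star_hom1 lH) mulr1.
- rewrite (star_homM ibH) !alphaE// (star_homM ibH) (star_homM lH) -!mulrA.
  by rewrite (mulr_eqA e1) mul1r.
- by rewrite (star_homS ibH) !alphaE// (star_homS ibH) (star_homS lH)
    !vn_starM vn_starK mulrA.
Qed.

Lemma alpha_iota lam n : Sg lam -> al lam (iota n) = iota (lam n).
Proof.
move=> Sl; apply: iotabar_inj; rewrite alphaE//.
have [_ e2] := braided_unitary eB Sl SgT.
have := braided_Hom eB Sl SgT n => /= ->.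
by rewrite -mulrA e2 mulr1.
Qed.

Lemma alpha_v lam : Sg lam -> al lam v = iota (e lam theta)^† * v.
Proof.
move=> Sl; apply: iotabar_inj; rewrite alphaE// (star_homM ibH).
exact: braid_iotabar_v.
Qed.

Lemma alpha_comp lam mu m : Sg lam -> Sg mu -> al (lam \o mu) m = al lam (al mu m).
Proof.
move=> Sl Sm; have lH := braided_star_hom eB Sl.
apply: iotabar_inj; rewrite !alphaE//; last exact: braided_comp eB _ _ Sl Sm.
rewrite (braided_compl eB Sl Sm SgT) vn_starM -(star_homS lH) /=.
by rewrite -!mulrA !(mulr_eqA (esym (star_homM lH _ _))) !(star_homM lH) -!mulrA.
Qed.

End OneBraiding.

(** * Braiding operators between the two alpha-inductions *)

Section OppositeBraidings.
Variables ep em : (N -> N) -> (N -> N) -> N.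
Hypotheses (epB : braided Sg ep) (emE : forall lam mu, em lam mu = (ep mu lam)^†).
Local Notation ap := (alpha NM iotabar ep).
Local Notation am := (alpha NM iotabar em).

Let emB : braided Sg em := braided_opp epB emE.

(* Naturality holds for all intertwiners in M, not only for those in N,
   because M = iota(N) v. *)
Lemma alpha_natl lam lam' mu t : Sg lam -> Sg lam' -> Sg mu ->
  Hom (ap lam) (ap lam') t ->
  am mu t * iota (ep lam mu) = iota (ep lam' mu) * t.
Proof.
move=> Sl Sl' Sm ht; have aH := alpha_star_hom emB Sm.
have ht' a : t * iota (lam a) = iota (lam' a) * t.
  by rewrite -!(alpha_iota epB).
have := coef_Hom ht'; move: (coefE t); move: (coef t) => n -> hn.
rewrite (star_homM aH) (alpha_iota emB)// (alpha_v emB)// emE vn_starK.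
rewrite -!mulrA [v * _]vP /= !(mulr_eqA (esym (star_homM ioH _ _))).
(* [n] intertwines theta lam with lam', and the hexagon for theta lam supplies the factor
   e(theta,mu) that came from alpha^-_mu(v). *)
have ST := braided_comp epB SgT Sl.
rewrite -(braided_natl epB ST Sl' Sm hn) (braided_compl epB SgT Sl Sm).
by rewrite -!mulrA.
Qed.

(** With m written as iota(n) v, the factor iota(n) is handled by the intertwining property in N,
    and the factor v leads to a Yang-Baxter equation. *)
Lemma alpha_braid_Hom lam mu : Sg lam -> Sg mu ->
  Hom (ap lam \o am mu) (am mu \o ap lam) (iota (ep lam mu)).
Proof.
move=> Sl Sm m /=.
have lH := alpha_star_hom epB Sl; have mH := alpha_star_hom emB Sm.
have c1 := braided_comp epB Sl SgT; have c2 := braided_comp epB SgT Sl.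
rewrite (coefE m); move: (coef m) => n.
rewrite !(star_homM mH, star_homM lH, alpha_iota emB, alpha_iota epB)//.
rewrite !(alpha_v emB, alpha_v epB)// !(star_homM mH, star_homM lH).
rewrite !(alpha_iota emB, alpha_iota epB)//.
rewrite !(alpha_v emB, alpha_v epB)// !emE vn_starK -!mulrA.
have /= := congr1 iota (braided_Hom epB Sl Sm n); rewrite !(star_homM ioH) => h.
rewrite (mulr_eqA h) -!mulrA; congr (_ * _).
rewrite [v * _]vP /= !mulrA -!(star_homM ioH); congr (iota _ * _).
have lH' := braided_star_hom epB Sl; have mH' := braided_star_hom epB Sm.
have muU := star_hom_unitary mH' (braided_unitary epB Sl SgT).
apply: (isometryI (unitary_isometry muU)); rewrite (star_homS mH') !mulrA muU.2 mul1r.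
(* Yang-Baxter: naturality under the intertwiner e(lam,theta) itself, expanded by the hexagons. *)
have := braided_natl epB c1 c2 Sm (braided_Hom epB Sl SgT).
rewrite (braided_compl epB Sl SgT Sm) (braided_compl epB SgT Sl Sm) !mulrA => ->.
by rewrite -!mulrA (braided_unitary epB Sl SgT).2 mulr1.
Qed.

End OppositeBraidings.

(* Exchanging the two braidings exchanges the two alpha-inductions. *)
Lemma alpha_natr ep em : braided Sg ep -> (forall lam mu, em lam mu = (ep mu lam)^†) ->
  forall lam mu mu' t, Sg lam -> Sg mu -> Sg mu' ->
  Hom (alpha NM iotabar em mu) (alpha NM iotabar em mu') t ->
  t * iota (ep lam mu) = iota (ep lam mu') * alpha NM iotabar ep lam t.
Proof.
move=> epB emE lam mu mu' t Sl Sm Sm' ht.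
have epE l m : ep l m = (em m l)^† by rewrite emE vn_starK.
have := alpha_natl (braided_opp epB emE) epE Sm Sm' Sl ht.
have [_ u2] := star_hom_unitary ioH (braided_unitary epB Sl Sm').
have [u1 _] := star_hom_unitary ioH (braided_unitary epB Sl Sm).
rewrite !emE !(star_homS ioH) => h.
rewrite -[RHS]mulr1 -u1 -mulrA [_ * (_ * iota _)]mulrA h -!mulrA.
by rewrite mulrA u2 mul1r.
Qed.

(** The formula of [rel_braiding_value] with the pair of braidings left abstract, so that the pair
    can be exchanged. *)
Definition rel_value ep em (bp bm : M -> M) (u : M) : Prop :=
  exists (lam mu : N -> N) (T S : M),
  [/\ Sg lam /\ Sg mu,
      Hom bp (alpha NM iotabar ep lam) T /\ is_isometry T,
      Hom bm (alpha NM iotabar em mu) S /\ is_isometry S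
    & u = S^† * (alpha NM iotabar em mu T)^† * iota (ep lam mu)
            * alpha NM iotabar ep lam S * T].

(** The adjoint of the formula is the same formula with T and S, lam and mu, and the two braidings
    exchanged. *)
Lemma rel_value_opp ep em bp bm u :
  (forall lam mu, em lam mu = (ep mu lam)^†) ->
  rel_value ep em bp bm u -> rel_value em ep bm bp u^†.
Proof.
move=> emE [lam [mu [T [S [[Sl Sm] hT hS ->]]]]].
exists mu, lam, S, T; split=> //.
by rewrite !vn_starM !vn_starK emE (star_homS ioH) !mulrA.
Qed.

(** * Values of the relative braiding: unitarity, intertwining and multiplicativity *)

Section RelativeBraiding.
Variables ep em : (N -> N) -> (N -> N) -> N.
Hypotheses (epB : braided Sg ep) (emE : forall lam mu, em lam mu = (ep mu lam)^†).
Local Notation ap := (alpha NM iotabar ep).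
Local Notation am := (alpha NM iotabar em).

Let emB : braided Sg em := braided_opp epB emE.
Let epE lam mu : ep lam mu = (em mu lam)^†.
Proof. by rewrite emE vn_starK. Qed.

(* The defining formula, freed from the choice of lam, mu, T and S; it makes
   independence of the choices and all later identities formal. *)
Lemma rel_valueP bp bm u lam mu T S : star_hom bp -> star_hom bm ->
  rel_value ep em bp bm u -> Sg lam -> Sg mu ->
  Hom bp (ap lam) T -> Hom bm (am mu) S ->
  am mu T * S * u = iota (ep lam mu) * ap lam S * T.
Proof.
move=> bpH bmH [lam0 [mu0 [T0 [S0 [[Sl0 Sm0] [hT0 T0I] [hS0 S0I] ->]]]]] Sl Sm hT hS.
have l0H := alpha_star_hom epB Sl0; have m0H := alpha_star_hom emB Sm0.
have lH := alpha_star_hom epB Sl; have mH := alpha_star_hom emB Sm.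
(* These intertwiners carry the choices defining [u] to the given ones; naturality moves them past
   e, and then the isometries T0 and S0 cancel. *)
have hx : Hom (ap lam0) (ap lam) (T * T0^†) by apply: HomM hT (Hom_star bpH l0H hT0).
have hy : Hom (am mu0) (am mu) (S * S0^†) by apply: HomM hS (Hom_star bmH m0H hS0).
rewrite -!mulrA [S * _]mulrA -(star_homS m0H) (mulr_eqA (hy _)) -!mulrA.
rewrite (mulr_eqA (esym (star_homM mH _ _))) [S * _]mulrA.
rewrite [S * _ * _]mulrA (alpha_natr epB emE Sl0 Sm0 Sm hy).
rewrite -!mulrA (mulr_eqA (esym (star_homM l0H _ _))) -!mulrA S0I mulr1.
rewrite (mulr_eqA (alpha_natl epB emE Sl0 Sl Sm hx)) -mulrA (mulr_eqA (hx S)).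
by rewrite -!mulrA T0I mulr1.
Qed.

(** By [rel_valueP], an isometry times [u] is a product of isometries, which forces [u] to be
    one. *)
Lemma rel_value_isometry bp bm u : star_hom bp -> star_hom bm ->
  rel_value ep em bp bm u -> is_isometry u.
Proof.
move=> bpH bmH hu; have [lam [mu [T [S [[Sl Sm] [hT TI] [hS SI] _]]]]] := hu.
have E := rel_valueP bpH bmH hu Sl Sm hT hS.
have W := isometryM (star_hom_isometry (alpha_star_hom emB Sm) TI) SI.
have V := isometryM (star_hom_isometry (alpha_star_hom epB Sl) SI) TI.
have U := unitary_isometry (star_hom_unitary ioH (braided_unitary epB Sl Sm)).
have := isometryM U V; rewrite mulrA -E /is_isometry vn_starM -mulrA.
by rewrite (mulr_eqA W) mul1r.
Qed.

Lemma rel_value_Hom bp bm u : star_hom bp -> star_hom bm ->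
  rel_value ep em bp bm u -> Hom (bp \o bm) (bm \o bp) u.
Proof.
move=> bpH bmH hu m /=; have [lam [mu [T [S [[Sl Sm] [hT TI] [hS SI] _]]]]] := hu.
have E := rel_valueP bpH bmH hu Sl Sm hT hS.
have lH := alpha_star_hom epB Sl; have mH := alpha_star_hom emB Sm.
have W := isometryM (star_hom_isometry mH TI) SI.
apply: (isometryI W); rewrite mulrA E -!mulrA hT (mulr_eqA (esym (star_homM lH _ _))) hS.
rewrite (star_homM lH) -!mulrA (mulr_eqA (alpha_braid_Hom epB emE Sl Sm m)) /= -!mulrA.
rewrite (mulr_eqA (hS _)) -!mulrA (mulr_eqA (esym (star_homM mH _ _))) hT (star_homM mH).
by rewrite -!mulrA; congr (_ * _); rewrite !mulrA.
Qed.

(** [rel_valueP] accepts intertwiners that are not isometries, so X may be absorbed into T. The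
    hexagon for the product l1 l2 then factors the result into the contributions of [u1] and
    [u2]. *)
Lemma rel_value_mul b1 b2 b3 bm u1 u2 u3 X :
  star_hom b1 -> star_hom b2 -> star_hom b3 -> star_hom bm ->
  rel_value ep em b1 bm u1 -> rel_value ep em b2 bm u2 -> rel_value ep em b3 bm u3 ->
  Hom b3 (b1 \o b2) X -> bm X * u3 = u1 * b1 u2 * X.
Proof.
move=> b1H b2H b3H bmH h1 h2 h3 hX.
have [l1 [mu [T1 [S [[Sl1 Sm] [hT1 T1I] [hS SI] _]]]]] := h1.
(* Only l2 and T2 come from the second value; all three values are evaluated with the same mu and
   S. *)
have [l2 [_ [T2 [_ [[Sl2 _] [hT2 T2I] _ _]]]]] := h2.
have l1H := alpha_star_hom epB Sl1; have mH := alpha_star_hom emB Sm.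
have S12 := braided_comp epB Sl1 Sl2.
have hT : Hom b3 (ap (l1 \o l2)) (ap l1 T2 * T1 * X).
  move=> a; rewrite (alpha_comp epB)// -!mulrA hX /= (mulr_eqA (hT1 _)) -!mulrA.
  by rewrite (mulr_eqA (esym (star_homM l1H _ _))) hT2 (star_homM l1H) -!mulrA.
have E1 := rel_valueP b1H bmH h1 Sl1 Sm hT1 hS.
have E2 := rel_valueP b2H bmH h2 Sl2 Sm hT2 hS.
have E3 := rel_valueP b3H bmH h3 S12 Sm hT hS.
have W := isometryM (isometryM (star_hom_isometry mH (star_hom_isometry l1H T2I))
  (star_hom_isometry mH T1I)) SI.
apply: (isometryI W).
transitivity (iota (ep (l1 \o l2) mu) * ap (l1 \o l2) S * (ap l1 T2 * T1 * X)).
  by rewrite -E3 !(star_homM mH) -!mulrA (mulr_eqA (hS X)) -!mulrA.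
rewrite (braided_compl epB Sl1 Sl2 Sm) (star_homM ioH) -(alpha_iota epB)//.
rewrite (alpha_comp epB)// -!mulrA !(mulr_eqA (esym (star_homM l1H _ _))) -E2.
rewrite !(star_homM l1H) -!mulrA (mulr_eqA (esym (hT1 _))).
rewrite (mulr_eqA (alpha_braid_Hom epB emE Sl1 Sm T2)) /= -!mulrA.
by rewrite (mulr_eqA3 (esym E1)) -!mulrA.
Qed.

End RelativeBraiding.

(** The adjoint is a value for the opposite braiding, so it is an isometry as well. *)
Lemma rel_value_unitary ep em bp bm u : braided Sg ep ->
  (forall lam mu, em lam mu = (ep mu lam)^†) -> star_hom bp -> star_hom bm ->
  rel_value ep em bp bm u -> is_unitary u.
Proof.
move=> epB emE bpH bmH hu; split; first exact (rel_value_isometry epB emE bpH bmH hu).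
have epE l m : ep l m = (em m l)^† by rewrite emE vn_starK.
have := rel_value_isometry (braided_opp epB emE) epE bmH bpH (rel_value_opp emE hu).
by rewrite /is_isometry vn_starK.
Qed.

(** The hypothesis is placed on the adjoints so that both signs become instances, with [ep] and [em]
    in either order. *)
Lemma half_braiding_rel_value ep em Phi tau (E : (M -> M) -> M) : braided Sg ep ->
  (forall lam mu, em lam mu = (ep mu lam)^†) ->
  (forall beta, Phi beta -> star_hom beta) -> Sigma Phi tau ->
  (forall beta, Phi beta -> rel_value ep em beta tau (E beta)^†) ->
  half_braiding Phi tau E.
Proof.
move=> epB emE PhiH St hE; have tH := Sigma_star_hom PhiH St.
have EU beta : Phi beta -> is_unitary (E beta).
  move=> Pb; rewrite -[E beta]vn_starK; apply: unitary_star.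
  exact: rel_value_unitary epB emE (PhiH _ Pb) tH (hE _ Pb).
split=> //.
- move=> beta Pb; split; first exact: EU.
  have bH := PhiH _ Pb; rewrite -[E beta]vn_starK; apply: Hom_star.
  + exact: star_hom_comp.
  + exact: star_hom_comp.
  + exact (rel_value_Hom epB emE bH tH (hE _ Pb)).
- move=> b1 b2 b3 P1 P2 P3 X hX; have b1H := PhiH _ P1.
  have := rel_value_mul epB emE b1H (PhiH _ P2) (PhiH _ P3) tH
    (hE _ P1) (hE _ P2) (hE _ P3) hX.
  rewrite (star_homS b1H) => h.
  have [_ U1] := EU _ P1; have [_ U2] := star_hom_unitary b1H (EU _ P2).
  have [U3 _] := EU _ P3.
  (* The multiplicativity relation for the adjoints becomes the one for E after multiplying by E(b3)
     on the right and cancelling the unitaries. *)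
  rewrite -[RHS]mulr1 -U3 -!mulrA [tau X * _]mulrA h -!mulrA.
  by rewrite (mulr_eqA U1) mul1r (mulr_eqA U2) mul1r.
Qed.

End AlphaInduction.

(** * Positivity of the statistical dimension *)

Section Index.
Variables (R : realType) (H K : hilbert R) (A : vnAlg H) (B : vnAlg K).

(** The Pimsner-Popa bound is tested at x = 1, where E(1) = 1, on a nonzero vector. *)
Lemma index_bound_ge1 (rho : A -> B) r : index_bounds rho r -> 1 <= r.
Proof.
move=> [E [_ _ _ [E1 _] _] /(_ 1)].
have p1 : vn_pos (1 : B) by move=> v; rewrite hdot_norm exprn_ge0.
have [v v0] := hilbert_neq0 K.
move=> /(_ p1 v); rewrite E1.
have -> : vn_val (r%:C%C *: 1 - 1 : B) v = (r - 1)%:C%C *: v.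
  have -> : vn_val (r%:C%C *: 1 - 1 : B) = r%:C%C *: (1 : bop K) - 1 by [].
  rewrite [LHS](bop_addE (_ *: _) (- _)) (bop_scaleE _ (1 : bop K)) (bop_oppE (1 : bop K)).
  by rewrite rmorphB rmorph1 scalerBl scale1r.
by rewrite hdotZl hdot_norm pmulr_lge0 ?exprn_gt0 ?normr_gt0// ler0c subr_ge0.
Qed.

(** The set of bounds is nonempty for a morphism, so its infimum is genuine and at least 1. This
    makes the scalar in the conjugate equations nonzero. *)
Lemma stat_dim_gt0 (rho : A -> B) : is_morphism rho -> 0 < stat_dim rho.
Proof.
move=> [_ ne]; rewrite sqrtr_gt0; apply: (lt_le_trans ltr01).
by apply: lb_le_inf => // r; apply: index_bound_ge1.
Qed.

End Index.

(** * The half-braidings of tau with respect to both chiral systems *)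

Theorem lemma4p1 (R : realType) (H : hilbert R) (N M : vnAlg H)
  (facN : typeIII_factor N) (facM : typeIII_factor M)
  (NM : vn_set N `<=` vn_set M)
  (iotabar : M -> N) (Hconj : is_conjugate (vn_incl NM) iotabar)
  (XN YN : set (N -> N)) (eps : (N -> N) -> (N -> N) -> N)
  (HXN : finite_system XN) (Hbraid : is_braiding XN eps)
  (HYN : finite_system YN) (HYX : YN `<=` XN)
  (Htheta : Sigma YN (iotabar \o vn_incl NM))
  (XM : set (M -> M)) (HXM : is_MM_sectors NM iotabar XN XM)
  (Er : (M -> M) -> (M -> M) -> M)
  (HEr : is_rel_braiding NM iotabar XN eps XM Er)
  (tau : M -> M) (Htau : Sigma (XM_zero NM iotabar XN eps XM) tau) :
  half_braiding (XM_plus NM iotabar XN eps XM) tau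
    (fun beta => (Er beta tau)^†) /\
  half_braiding (XM_minus NM iotabar XN eps XM) tau
    (fun beta => Er tau beta).
Proof.
have [ioM [ibH _] [w [v [[wP _] [vP vI] wv _]]]] := Hconj; have [ioH _] := ioM.
have c0 : ((stat_dim (vn_incl NM))^-1)%:C%C != 0 :> R[i].
  by rewrite fmorph_eq0 invr_eq0 gt_eqF// stat_dim_gt0.
have [_ XN1 [XNm _] _ XNM] := HXN.
have epB : braided (Sigma XN) (eps_plus XN eps).
  by apply: eps_plus_braided => // lam /XNm[[]].
have SgT := Sigma_sub HYX Htheta.
have XMH beta : XM beta -> star_hom beta by have [_ h _ _] := HXM => /h[[]].
have tp : Sigma (XM_plus NM iotabar XN eps XM) tau.
  by apply: Sigma_sub Htau => beta [].
have tm : Sigma (XM_minus NM iotabar XN eps XM) tau.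
  by apply: Sigma_sub Htau => beta [].
have emE lam mu : eps_minus XN eps lam mu = (eps_plus XN eps mu lam)^† by [].
have epE lam mu : eps_plus XN eps lam mu = (eps_minus XN eps mu lam)^†.
  by rewrite emE vn_starK.
split.
- apply: (half_braiding_rel_value ioH ibH wP vP vI c0 wv SgT epB emE) => //
    [beta [/XMH]//|beta Xb].
  by rewrite vn_starK; apply: HEr => //; apply: Sigma_id.
(* With the braidings exchanged, [(Er tau beta)^†] is a value for the pair (beta, tau). *)
- apply: (half_braiding_rel_value ioH ibH wP vP vI c0 wv SgT
    (braided_opp epB emE) epE) => // [beta [/XMH]//|beta Xb].
  apply: (rel_value_opp ioH emE).
  by apply: HEr => //; apply: Sigma_id.
Qed.
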